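(* Fix an integer $m \geq 1$. The sequence (indexed by $n$) of random walks on the generalized symmetric groups $G_{m,n}$ driven by the unbiased one-sided transposition shuffle $OST_{m,n}$ exhibits a cutoff at time $n\log n$, both in total variation distance and in separation distance.
   Context: Let $\xi$ be a primitive $m$-th root of unity and $[n]=\{1,\dots,n\}$. The generalized symmetric group $G_{m,n}$ (of order $m^n n!$) is the set of tuples $(\xi^{k_1},\dots,\xi^{k_n},\sigma)$ with $k_i\in\mathbb{Z}_m$, $\sigma\in S_n$, with multiplication $(\xi^{k_1},\dots,\xi^{k_n},\sigma)(\xi^{k_1'},\dots,\xi^{k_n'},\sigma')=(\xi^{k_1}\xi^{k'_{\sigma(1)}},\dots,\xi^{k_n}\xi^{k'_{\sigma(n)}},\sigma\sigma')$; equivalently, the bijections $\varphi$ of $\{\xi^k i: i\in[n],k\in\mathbb{Z}_m\}$ with $\varphi(\xi^k i)=\xi^k\varphi(i)$. For $1\le i\le j\le n$ and $k\in\mathbb{Z}_m$ let $g_{i,j,k}\in G_{m,n}$ be the element whose permutation part is the transposition $(ij)$ (the identity if $i=j$) and whose tuple has entry $\xi^k$ in positions $i$ and $j$ and $1$ elsewhere. The OST shuffle $OST_{m,n}$ is the random walk on $G_{m,n}$ whose step distribution is the law of $g_{i,j,k}$ where $j$ is uniform on $[n]$, then $i$ uniform on $[j]$, and $k$ uniform on $\mathbb{Z}_m$ independently (so each triple $(i,j,k)$ has probability $\frac{1}{njm}$). $OST^t_{m,n}$ denotes the $t$-fold convolution (distribution after $t$ steps from the identity), and $U_{m,n}$ is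 the uniform distribution on $G_{m,n}$. Total variation distance: $\|P-Q\|_{TV}=\frac12\sum_g|P(g)-Q(g)|$. Separation distance: $\|P-U\|_{Sep}=1-\min_{g} P(g)/U(g)$. A sequence of chains with distances $d_n(t)$ has a cutoff at time $t_n$ if there is a window $w_n$ with $w_n/t_n\to 0$ such that $\lim_{\alpha\to-\infty}\liminf_{n\to\infty} d_n(t_n+\alpha w_n)=1$ and $\lim_{\alpha\to\infty}\limsup_{n\to\infty} d_n(t_n+\alpha w_n)=0$. *)

(* Defs.v *)
From HB Require Import structures.
From mathcomp Require Import all_boot all_order all_algebra all_fingroup.
From mathcomp Require Import all_classical all_reals all_analysis.
Set Implicit Arguments. Unset Strict Implicit. Unset Printing Implicit Defensive.
Import Order.TTheory GRing.Theory Num.Theory.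
Import numFieldNormedType.Exports.
Local Open Scope classical_set_scope.
Local Open Scope ring_scope.

(* Z_m is represented by 'I_m (m >= 1), with addition modulo m;
   xi^k is encoded by the exponent k : 'I_m. *)
Definition addZm (m : nat) (a b : 'I_m) : 'I_m :=
  Ordinal (ltn_pmod (a + b)%N (leq_ltn_trans (leq0n a) (ltn_ord a))).

Definition Gmn (m n : nat) : finType := ({ffun 'I_n -> 'I_m} * {perm 'I_n})%type.

(* (xi^k, sigma)(xi^k', sigma') = (xi^(k_i + k'_(sigma i)), sigma sigma').
   mathcomp's product on perms is (s * t) x = t (s x), which is the
   convention making this law associative. *)
Definition mulG (m n : nat) (g h : Gmn m n) : Gmn m n :=
  ([ffun i => addZm (g.1 i) (h.1 (g.2 i))], (g.2 * h.2)%g).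

Definition gen (m n : nat) (i j : 'I_n) (k : 'I_m) : Gmn m n :=
  ([ffun l => if (l == i) || (l == j) then k
              else Ordinal (leq_ltn_trans (leq0n k) (ltn_ord k))], tperm i j).

(* step law of OST_{m,n}; indices are 0-based: j uniform in [n],
   i uniform in [j], k uniform in Z_m; weight 1/(n j m). *)
Definition ost (R : realType) (m n : nat) (g : Gmn m n) : R :=
  \sum_(j : 'I_n) \sum_(i : 'I_n | (i <= j)%N) \sum_(k : 'I_m)
     (if gen i j k == g then (n%:R * (j.+1)%:R * m%:R)^-1 else 0).

Definition delta_id (R : realType) (m n : nat) (g : Gmn m n) : R :=
  if [forall i, (g.1 i == 0 :> nat)] && (g.2 == 1%g) then 1 else 0.

Definition conv (R : realType) (m n : nat) (P Q : Gmn m n -> R) (g : Gmn m n) : R :=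
  \sum_(h1 : Gmn m n) \sum_(h2 : Gmn m n)
     (if mulG h1 h2 == g then P h1 * Q h2 else 0).

Definition ost_t (R : realType) (m n t : nat) : Gmn m n -> R :=
  iter t (fun P => conv P (@ost R m n)) (@delta_id R m n).

Definition unif (R : realType) (m n : nat) (g : Gmn m n) : R :=
  (#|Gmn m n|%:R)^-1.

Definition tv_dist (R : realType) (m n : nat) (P Q : Gmn m n -> R) : R :=
  2^-1 * \sum_(g : Gmn m n) `|P g - Q g|.

(* separation distance 1 - min_g P(g)/U(g); the minimum over the finite
   nonempty group is taken as a big min seeded with the value at the
   identity element (which lies in the range of g). *)
Definition id_elt (m n : nat) (hm : (0 < m)%N) : Gmn m n :=
  ([ffun => Ordinal hm], 1%g).

Definition sep_dist (R : realType) (m n : nat) (hm : (0 < m)%N)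
    (P Q : Gmn m n -> R) : R :=
  1 - \big[Num.min / P (id_elt n hm) / Q (id_elt n hm)]_(g : Gmn m n) (P g / Q g).

(* distance at a real time s: evaluated at floor(s) (and at 0 if s < 0) *)
Definition at_real_time (R : realType) (d : nat -> R) (s : R) : R :=
  d (Num.truncn s).

Definition has_cutoff (R : realType) (d : nat -> nat -> R) (t : nat -> R) : Prop :=
  exists w : nat -> R,
    (forall n, 0 < w n) /\
    ((fun n => w n / t n) @ \oo --> (0 : R)) /\
    ((fun a : R => limn_inf (fun n => at_real_time (d n) (t n + a * w n)))
        @ -oo --> (1 : R)) /\
    ((fun a : R => limn_sup (fun n => at_real_time (d n) (t n + a * w n)))
        @ +oo --> (0 : R)).

(* Main.v *)
Require Import Defs.
From mathcomp Require Import all_boot all_order all_algebra all_fingroup.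
From mathcomp Require Import all_classical all_reals all_analysis.
From mathcomp Require Import ring lra.
Set Implicit Arguments. Unset Strict Implicit. Unset Printing Implicit Defensive.
Import Order.TTheory GRing.Theory Num.Theory.
Import numFieldNormedType.Exports.
Local Open Scope ring_scope.

(** Write [T_j] for the Markov operator of a step with right-hand position [j],
    and [E_r] for the average over the copy of [G_{m,r}] acting on the first [r]
    positions.  For [m > 2] the [T_j] do not commute with each other, but they
    commute with every [E_r], and [T_r E_{r-1} = E_r].  Hence a product of [T_j]'s
    in which every index occurs, in any order and with any repetitions, equals
    [E_n], the uniform average.  So the separation distance is at most the
    probability that a coupon collector has not finished,
    [n (1 - 1/n)^t <= n exp(- t/n)].

    For the lower bound, consider the last [n / ln n] positions.  One of them is
    touched in one step with probability about [1/n], up to a factor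
    [1 + O(1 / ln n)], and two of them are almost independent; by the second moment
    method, at time [n (ln n - sqrt (ln n))] some of them have never been touched,
    hence are fixed points, whereas under the uniform distribution a fixed point
    among them has probability at most [1 / ln n]. *)

(** * The group law *)

Section GroupLaw.
Variables m n : nat.
Implicit Types (g h x : Gmn m.+1 n) (i j l : 'I_n) (k : 'I_m.+1).

Definition oneG : Gmn m.+1 n := ([ffun => 0], 1%g).

(** With modulus [m.+1] the exponents ['I_m.+1] form an additive group, whose addition has the same
    values as [addZm]. *)
Lemma mulG1E g h l : (mulG g h).1 l = g.1 l + h.1 (g.2 l).
Proof. by rewrite ffunE; apply: val_inj. Qed.

Lemma mulG2E g h l : (mulG g h).2 l = h.2 (g.2 l).
Proof. by rewrite permM. Qed.

Lemma eqG g h : (forall l, g.1 l = h.1 l) -> (forall l, g.2 l = h.2 l) -> g = h.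
Proof.
by case: g h => [a s] [b t] /= e1 e2; congr pair; [apply/ffunP | apply/permP].
Qed.

Lemma mulGA : associative (@mulG m.+1 n).
Proof.
move=> g h x; apply: eqG => l.
  by rewrite !(mulG1E, mulG2E) addrA.
by rewrite !mulG2E.
Qed.

Lemma mulG1 g : mulG g oneG = g.
Proof.
apply: eqG => l; first by rewrite mulG1E ffunE addr0.
by rewrite mulG2E perm1.
Qed.

Lemma mul1G g : mulG oneG g = g.
Proof.
apply: eqG => l; first by rewrite mulG1E ffunE add0r perm1.
by rewrite mulG2E perm1.
Qed.

#[local] Opaque mulG.

Lemma mulGI g : injective (mulG g).
Proof.
move=> h x e; apply: eqG => l; rewrite -(permKV g.2 l).
  by have := congr1 (fun y : Gmn _ _ => y.1 ((g.2^-1)%g l)) e; rewrite /= !mulG1E => /addrI.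
by have := congr1 (fun y : Gmn _ _ => y.2 ((g.2^-1)%g l)) e; rewrite /= !mulG2E.
Qed.

Lemma gen1E i j k l :
  (gen i j k).1 l = if (l == i) || (l == j) then k else 0.
Proof. by rewrite ffunE; case: ifP => // _; apply: val_inj. Qed.

Lemma gen2E i j k l : (gen i j k).2 l = tperm i j l.
Proof. by []. Qed.

#[local] Opaque gen.

(** Both swapped positions carry the same exponent, so the swap leaves the tuple unchanged and
    negating [k] inverts the generator. *)
Lemma genVr i j k : mulG (gen i j k) (gen i j (- k)) = oneG.
Proof.
apply: eqG => l; last by rewrite mulG2E !gen2E tpermK perm1.
rewrite mulG1E !gen1E gen2E [in RHS]ffunE.
by case: tpermP => [->|->|/eqP/negPf-> /eqP/negPf->];
  rewrite ?eqxx ?orbT ?subrr ?addr0.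
Qed.

Lemma genVl i j k : mulG (gen i j (- k)) (gen i j k) = oneG.
Proof. by rewrite -[in X in mulG _ X](opprK k) genVr. Qed.

Lemma mulG_genK i j k g : mulG (mulG g (gen i j k)) (gen i j (- k)) = g.
Proof. by rewrite -mulGA genVr mulG1. Qed.

Lemma mulG_genVK i j k g : mulG (mulG g (gen i j (- k))) (gen i j k) = g.
Proof. by rewrite -mulGA genVl mulG1. Qed.

Lemma gen_mulGK i j k g : mulG (gen i j (- k)) (mulG (gen i j k) g) = g.
Proof. by rewrite mulGA genVl mul1G. Qed.

Lemma gen_mulGVK i j k g : mulG (gen i j k) (mulG (gen i j (- k)) g) = g.
Proof. by rewrite mulGA genVr mul1G. Qed.

Definition fixes g l := (g.1 l == 0) && (g.2 l == l).

(* A copy of G_{m,|A|} inside G_{m,n}. *)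
Definition suppG (A : {set 'I_n}) : {set Gmn m.+1 n} :=
  [set g | [forall l, (l \notin A) ==> fixes g l]].

Lemma suppGP (A : {set 'I_n}) g :
  reflect (forall l, l \notin A -> fixes g l) (g \in suppG A).
Proof.
rewrite inE; apply: (iffP forallP) => h l; first exact/implyP/h.
exact/implyP/h.
Qed.

Lemma fixesM g h l : fixes g l -> fixes h l -> fixes (mulG g h) l.
Proof.
move=> /andP[/eqP g1 /eqP g2] /andP[/eqP h1 /eqP h2].
by rewrite /fixes mulG1E mulG2E g2 g1 h1 h2 addr0 !eqxx.
Qed.

Lemma fixes_gen i j k l : l != i -> l != j -> fixes (gen i j k) l.
Proof.
move=> li lj; rewrite /fixes gen1E gen2E (negPf li) (negPf lj) /=.
by rewrite tpermD ?eqxx // eq_sym.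
Qed.

Lemma one_suppG A : oneG \in suppG A.
Proof. by apply/suppGP => l _; rewrite /fixes ffunE perm1 !eqxx. Qed.

Lemma mulG_suppG A g h : g \in suppG A -> h \in suppG A -> mulG g h \in suppG A.
Proof.
by move=> /suppGP gA /suppGP hA; apply/suppGP => l lA; rewrite fixesM ?gA ?hA.
Qed.

Lemma gen_suppG (A : {set 'I_n}) i j k : i \in A -> j \in A -> gen i j k \in suppG A.
Proof.
move=> iA jA; apply/suppGP => l lA; apply: fixes_gen.
  by apply: contraNneq lA => ->.
by apply: contraNneq lA => ->.
Qed.

Lemma suppGS (A B : {set 'I_n}) : A \subset B -> suppG A \subset suppG B.
Proof.
move=> AB; apply/fintype.subsetP => g /suppGP gA; apply/suppGP => l lB.
by apply: gA; apply: contra lB; apply: (fintype.subsetP AB).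
Qed.

Lemma suppG0 : suppG finset.set0 = [set oneG].
Proof.
apply/setP => g; rewrite inE; apply/idP/eqP => [|->]; last exact: one_suppG.
move=> /suppGP h; apply: eqG => l; have /andP[/eqP e1 /eqP e2] := h l (negbT (finset.in_set0 l)).
  by rewrite e1 ffunE.
by rewrite e2 perm1.
Qed.

Lemma suppGT : suppG finset.setT = finset.setT.
Proof. by apply/setP => g; rewrite !inE; apply/forallP => l; rewrite inE. Qed.

Section Sums.
Variables (V : nmodType) (F : Gmn m.+1 n -> V) (A : {set 'I_n}) (j : 'I_n).
Hypothesis jA : j \notin A.

(* The elements [gen i j k] form both a left and a right transversal of suppG A in
   suppG (j |: A). *)
Lemma sum_suppG_genr :
  \sum_(x in suppG (j |: A)) F x =
  \sum_(i in j |: A) \sum_k \sum_(h in suppG A) F (mulG h (gen i j k)).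
Proof.
(* When [h] fixes [j], the product [mulG h (gen i j k)] sends [j] to [i] with exponent [k], so these
   two values recover the generator. *)
rewrite (partition_big (fun x => x.2 j) (fun i => i \in j |: A)) /=; last first.
  move=> x /suppGP xA; apply: contraT => xj.
  have /andP[_ /eqP /perm_inj xjj] := xA _ xj.
  by rewrite xjj setU11 in xj.
apply: eq_bigr => i iA.
rewrite (partition_big (fun x => x.1 j) predT) //=; apply: eq_bigr => k _.
rewrite (reindex_onto (fun h => mulG h (gen i j k))
           (fun x => mulG x (gen i j (- k)))) /=; last first.
  by move=> x _; rewrite mulG_genVK.
apply: eq_bigl => h; rewrite mulG_genK eqxx andbT.
apply/idP/idP; last first.
  move=> hA; rewrite mulG1E mulG2E.
  have /suppGP/(_ _ jA)/andP[/eqP-> /eqP->] := hA.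
  rewrite gen1E eqxx orbT add0r gen2E tpermR !eqxx !andbT.
  apply: mulG_suppG; last by rewrite gen_suppG // setU11.
  by move: hA; apply/fintype.subsetP/suppGS/finset.subsetUr.
case/andP => /andP[/suppGP xA /eqP x2] /eqP x1; apply/suppGP => l lA.
rewrite -(mulG_genK i j k h); set x := mulG h _ in xA x2 x1 *.
have [->|lj] := eqVneq l j.
  by rewrite /fixes mulG1E mulG2E x1 x2 gen1E eqxx gen2E tpermL subrr !eqxx.
have lA' : l \notin j |: A by rewrite in_setU1 negb_or lj.
apply: fixesM; first exact: xA.
by apply: fixes_gen => //; apply: contraNneq lA' => ->.
Qed.

Lemma sum_suppG_genl :
  \sum_(x in suppG (j |: A)) F x =
  \sum_(i in j |: A) \sum_k \sum_(h in suppG A) F (mulG (gen i j k) h).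
Proof.
(* In this order [i] is the preimage of [j], and [k] is the exponent at [i]. *)
rewrite (partition_big (fun x => (x.2^-1)%g j) (fun i => i \in j |: A)) /=; last first.
  move=> x /suppGP xA; apply: contraT => xj.
  have /andP[_] := xA _ xj; rewrite permKV => /eqP jx.
  by rewrite -jx setU11 in xj.
apply: eq_bigr => i iA.
rewrite (partition_big (fun x => x.1 i) predT) //=; apply: eq_bigr => k _.
rewrite (reindex_onto (fun h => mulG (gen i j k) h)
           (fun x => mulG (gen i j (- k)) x)) /=; last first.
  by move=> x _; rewrite gen_mulGVK.
apply: eq_bigl => h; rewrite gen_mulGK eqxx andbT.
have eV (x : Gmn m.+1 n) : ((x.2^-1)%g j == i) = (x.2 i == j).
  by rewrite eq_sym -(inj_eq (@perm_inj _ x.2)) permKV.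
rewrite (eV (mulG _ _)).
apply/idP/idP; last first.
  move=> hA; rewrite mulG1E mulG2E gen1E gen2E tpermL eqxx.
  have /suppGP/(_ _ jA)/andP[/eqP-> /eqP->] := hA.
  rewrite addr0 !eqxx !andbT.
  apply: mulG_suppG; first by rewrite gen_suppG // setU11.
  by move: hA; apply/fintype.subsetP/suppGS/finset.subsetUr.
case/andP => /andP[/suppGP xA /eqP x2] /eqP x1; apply/suppGP => l lA.
rewrite -(gen_mulGK i j k h); set x := mulG _ h in xA x2 x1 *.
have [->|lj] := eqVneq l j.
  by rewrite /fixes mulG1E mulG2E gen1E gen2E tpermR x1 x2 eqxx orbT addNr !eqxx.
have lA' : l \notin j |: A by rewrite in_setU1 negb_or lj.
apply: fixesM; last exact: xA.
by apply: fixes_gen => //; apply: contraNneq lA' => ->.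
Qed.

End Sums.

Lemma sum_suppG_mulr (V : nmodType) (F : Gmn m.+1 n -> V) (A : {set 'I_n}) i j k :
  i \in A -> j \in A ->
  \sum_(h in suppG A) F (mulG h (gen i j k)) = \sum_(h in suppG A) F h.
Proof.
move=> iA jA; rewrite [RHS](reindex_onto (fun h => mulG h (gen i j k))
           (fun x => mulG x (gen i j (- k)))) /=; last first.
  by move=> x _; rewrite mulG_genVK.
apply: eq_bigl => h; rewrite mulG_genK eqxx andbT.
apply/idP/idP => hA; first by rewrite mulG_suppG ?gen_suppG.
by rewrite -(mulG_genK i j k h) mulG_suppG ?gen_suppG.
Qed.

Lemma sum_suppG_mull (V : nmodType) (F : Gmn m.+1 n -> V) (A : {set 'I_n}) i j k :
  i \in A -> j \in A ->
  \sum_(h in suppG A) F (mulG (gen i j k) h) = \sum_(h in suppG A) F h.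
Proof.
move=> iA jA; rewrite [RHS](reindex_onto (fun h => mulG (gen i j k) h)
           (fun x => mulG (gen i j (- k)) x)) /=; last first.
  by move=> x _; rewrite gen_mulGVK.
apply: eq_bigl => h; rewrite gen_mulGK eqxx andbT.
apply/idP/idP => hA; first by rewrite mulG_suppG ?gen_suppG.
by rewrite -(gen_mulGK i j k h) mulG_suppG ?gen_suppG.
Qed.

End GroupLaw.

(** * Markov operators and the coupon collector bound *)

Section Operators.
Variables (R : realType) (m n : nat).
Notation G := (Gmn m.+1 n).
Implicit Types (f : G -> R) (g h x : G) (i j l : 'I_n) (k : 'I_m.+1) (A : {set 'I_n}).

(** This is [T_j] of the overview. The generator stands on the right, the side on which [conv]
    appends a step. *)
Definition stepT j f g : R :=
  (j.+1%:R * m.+1%:R)^-1 * \sum_(i : 'I_n | (i <= j)%N) \sum_k f (mulG g (gen i j k)).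

Definition stepK f g : R := n%:R^-1 * \sum_j stepT j f g.

Lemma sum_conv (P Q : G -> R) f :
  \sum_g Defs.conv P Q g * f g = \sum_h P h * \sum_x Q x * f (mulG h x).
Proof.
transitivity (\sum_g \sum_h \sum_x (if mulG h x == g then P h * Q x * f g else 0)).
  apply: eq_bigr => g _; rewrite /Defs.conv mulr_suml; apply: eq_bigr => h _.
  by rewrite mulr_suml; apply: eq_bigr => x _; case: ifP => // _; rewrite mul0r.
rewrite exchange_big; apply: eq_bigr => h _; rewrite exchange_big mulr_sumr.
apply: eq_bigr => x _; rewrite -big_mkcond /= (eq_bigl (pred1 (mulG h x))).
  by rewrite big_pred1_eq mulrA.
by move=> g; rewrite eq_sym.
Qed.

Lemma sum_ost f g : \sum_x ost R x * f (mulG g x) = stepK f g.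
Proof.
rewrite /ost /stepK mulr_sumr.
under eq_bigr => x _ do rewrite mulr_suml.
rewrite exchange_big; apply: eq_bigr => j _.
rewrite /stepT mulrA -invfM mulrA mulr_sumr.
under eq_bigr => x _ do rewrite mulr_suml.
rewrite exchange_big; apply: eq_bigr => i _; rewrite mulr_sumr.
under eq_bigr => x _ do rewrite mulr_suml.
rewrite exchange_big; apply: eq_bigr => k _.
under eq_bigr => x _ do rewrite (fun_if (fun y => y * _)) mul0r.
by rewrite -big_mkcond /= (eq_bigl (pred1 (gen i j k))) ?big_pred1_eq// => x; rewrite eq_sym.
Qed.

Lemma sum_delta_id f : \sum_g delta_id R g * f g = f (oneG m n).
Proof.
rewrite (bigD1 (oneG m n)) //= big1 ?addr0 => [|g /negPf g1].
  rewrite /delta_id eqxx andbT; case: ifPn; first by rewrite mul1r.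
  by case/forallPn => i; rewrite ffunE.
rewrite /delta_id; case: ifP; last by rewrite mul0r.
case/andP => /forallP h /eqP e2; move: g1; rewrite (_ : g = oneG m n) ?eqxx//.
apply: eqG => l; last by rewrite e2.
rewrite ffunE; apply: val_inj; exact/eqP/(h l).
Qed.

(** Pairing the law with a test function moves the steps onto the function, so both bounds come from
    iterating [stepK] on a suitable [f]. *)
Lemma sum_ost_t t f :
  \sum_g @ost_t R m.+1 n t g * f g = iter t stepK f (oneG m n).
Proof.
elim: t f => [|t IH] f; first exact: sum_delta_id.
rewrite iterSr -IH sum_conv; apply: eq_bigr => g _.
by rewrite sum_ost.
Qed.

Lemma card_ord_le j : #|[pred i : 'I_n | (i <= j)%N]| = j.+1.
Proof.
rewrite -sum1_card -(big_ord_widen n (fun=> 1%N) (ltn_ord j)).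
by rewrite sum1_card card_ord.
Qed.

Lemma stepT_cst j f g c :
  (forall i k, (i <= j)%N -> f (mulG g (gen i j k)) = c) -> stepT j f g = c.
Proof.
move=> fc; rewrite /stepT (eq_bigr (fun=> c *+ m.+1)) => [|i ij].
  rewrite sumr_const card_ord_le -mulrnA -[c *+ _]mulr_natr mulrC -mulrA natrM.
  by rewrite [X in _ * X](_ : _ = 1) ?mulr1// [X in X / _]mulrC mulfV// mulf_neq0 ?pnatr_eq0.
by rewrite (eq_bigr (fun=> c)) ?sumr_const ?card_ord// => k _; apply: fc.
Qed.

Lemma ler_stepT j f1 f2 :
  (forall g, f1 g <= f2 g) -> forall g, stepT j f1 g <= stepT j f2 g.
Proof.
move=> f12 g; apply: ler_wpM2l; first by rewrite invr_ge0 mulr_ge0.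
by apply: ler_sum => i _; apply: ler_sum => k _.
Qed.

(** * Averages over subgroups: [avgE (below r)] is [E_r] *)

Definition avgE A f g : R :=
  #|suppG m A|%:R^-1 * \sum_(h in suppG m A) f (mulG g h).

Lemma avgE_lin A (I : Type) (r : seq I) c (F : I -> G -> R) g :
  avgE A (fun x => c * \sum_(i <- r) F i x) g =
  c * \sum_(i <- r) avgE A (F i) g.
Proof.
rewrite /avgE -mulr_sumr mulrCA; congr (_ * _).
by rewrite exchange_big mulr_sumr.
Qed.

Definition below (r : nat) : {set 'I_n} := [set i : 'I_n | (i < r)%N].

Lemma in_below r i : (i \in below r) = (i < r)%N.
Proof. by rewrite inE. Qed.

Lemma belowS j : below j.+1 = j |: below j.
Proof. by apply/setP => i; rewrite !inE ltnS leq_eqVlt. Qed.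

(** For [i <= j < r] the generator lies in the subgroup averaged over, and left translation by it
    permutes that subgroup. *)
Lemma stepT_avgE_id r j f g :
  (j < r)%N -> stepT j (avgE (below r) f) g = avgE (below r) f g.
Proof.
move=> jr; apply: stepT_cst => i k ij; congr (_ * _).
under eq_bigr => h _ do rewrite -mulGA.
by rewrite (sum_suppG_mull (fun h => f (mulG g h))) // in_below // (leq_ltn_trans ij).
Qed.

Lemma avgE_stepT_id r j f g :
  (j < r)%N -> avgE (below r) (stepT j f) g = avgE (below r) f g.
Proof.
move=> jr; rewrite -[RHS](@stepT_cst j (fun=> avgE (below r) f g) g) //.
rewrite /avgE /stepT -mulr_sumr mulrCA; congr (_ * _).
rewrite [in LHS]exchange_big mulr_sumr /=; apply: eq_bigr => i ij.
rewrite [in LHS]exchange_big mulr_sumr /=; apply: eq_bigr => k _.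
congr (_ * _).
under eq_bigr => h _ do rewrite -mulGA.
by rewrite (sum_suppG_mulr (fun h => f (mulG g h))) // in_below // (leq_ltn_trans ij).
Qed.

Lemma suppG_gen_comm A i j k h : i \notin A -> j \notin A -> h \in suppG m A ->
  mulG h (gen i j k) = mulG (gen i j k) h.
Proof.
move=> iA jA /suppGP hA.
have [/andP[/eqP i1 /eqP i2] /andP[/eqP j1 /eqP j2]] := (hA _ iA, hA _ jA).
have hij l : l != i -> l != j -> (h.2 l != i) && (h.2 l != j).
  move=> li lj; rewrite -{1}i2 -{1}j2 !(inj_eq perm_inj); exact/andP.
apply: eqG => l; last first.
  rewrite !mulG2E !gen2E; case: (tpermP i j l) => [->|->|/eqP li /eqP lj].
  - by rewrite i2 tpermL j2.
  - by rewrite j2 tpermR i2.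
  - by have /andP[? ?] := hij _ li lj; rewrite tpermD // eq_sym.
rewrite !mulG1E !gen1E gen2E.
case: (tpermP i j l) => [->|->|/eqP li /eqP lj].
- by rewrite i1 i2 j1 eqxx add0r addr0.
- by rewrite j1 j2 i1 eqxx orbT add0r addr0.
- have /andP[/negPf-> /negPf->] := hij _ li lj.
  by rewrite (negPf li) (negPf lj) addr0 add0r.
Qed.

(** If [j < r], both sides are the average itself. Otherwise the indices [i] in [j |: below r] are
    treated together: the left and right transversals give the same total. For every other [i] the
    generator commutes with the whole subgroup. *)
Lemma stepT_avgE_comm r j f :
  stepT j (avgE (below r) f) = avgE (below r) (stepT j f).
Proof.
apply/funext => g.
have [jr|rj] := ltnP j r; first by rewrite stepT_avgE_id // avgE_stepT_id.
have jA : j \notin below r by rewrite in_below -leqNgt.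
transitivity ((j.+1%:R * m.+1%:R)^-1 * (#|suppG m (below r)|%:R^-1 *
  \sum_(i : 'I_n | (i <= j)%N) \sum_k \sum_(h in suppG m (below r))
     f (mulG g (mulG (gen i j k) h)))).
  rewrite /stepT; congr (_ * _); rewrite [in RHS]mulr_sumr; apply: eq_bigr => i _.
  rewrite [in RHS]mulr_sumr; apply: eq_bigr => k _; congr (_ * _).
  by apply: eq_bigr => h _; rewrite mulGA.
transitivity ((j.+1%:R * m.+1%:R)^-1 * (#|suppG m (below r)|%:R^-1 *
  \sum_(i : 'I_n | (i <= j)%N) \sum_k \sum_(h in suppG m (below r))
     f (mulG g (mulG h (gen i j k))))); last first.
  rewrite /avgE /stepT -mulr_sumr mulrCA; congr (_ * (_ * _)).
  rewrite [RHS]exchange_big; apply: eq_bigr => i _.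
  rewrite [RHS]exchange_big; apply: eq_bigr => k _.
  by apply: eq_bigr => h _; rewrite mulGA.
congr (_ * (_ * _)).
have sub i : (i <= j)%N && (i \in j |: below r) = (i \in j |: below r).
  rewrite in_setU1 in_below; case: eqVneq => [->|_] /=; first by rewrite leqnn.
  by case: ltnP => ir; rewrite ?andbF // andbT ltnW // (leq_trans ir).
rewrite (bigID (mem (j |: below r))) [RHS](bigID (mem (j |: below r))) /=.
congr (_ + _).
  rewrite !(eq_bigl _ _ sub).
  pose F x := f (mulG g x).
  exact: etrans (esym (sum_suppG_genl F jA)) (sum_suppG_genr F jA).
apply: eq_bigr => i /andP[_]; rewrite in_setU1 negb_or => /andP[_ iA].
apply: eq_bigr => k _; apply: eq_bigr => h hA.
by rewrite (suppG_gen_comm _ iA jA hA).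
Qed.

Lemma card_suppGS j : #|suppG m (below j.+1)| = (j.+1 * m.+1 * #|suppG m (below j)|)%N.
Proof.
have jA : j \notin below j by rewrite in_below ltnn.
rewrite belowS -sum1_card (sum_suppG_genl (fun=> 1%N) jA).
rewrite -belowS (eq_bigl (fun i => (i <= j)%N)) => [|i]; last by rewrite in_below ltnS.
under eq_bigr => i _ do rewrite sum_nat_const card_ord sum1_card.
by rewrite sum_nat_const card_ord_le mulnA.
Qed.

(** The identity [T_r E_{r-1} = E_r] with positions counted from 0: the generators with right-hand
    position [j] represent each coset of the smaller subgroup once. *)
Lemma stepT_avgES j f : stepT j (avgE (below j) f) = avgE (below j.+1) f.
Proof.
have jA : j \notin below j by rewrite in_below ltnn.
apply/funext => g; rewrite /avgE card_suppGS belowS.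
rewrite (sum_suppG_genl (fun h => f (mulG g h)) jA) !natrM invfM -mulrA.
rewrite -belowS (eq_bigl (fun i => (i <= j)%N)) => [|i]; last by rewrite in_below ltnS.
rewrite /stepT; congr (_ * _); rewrite mulr_sumr; apply: eq_bigr => i _.
rewrite mulr_sumr; apply: eq_bigr => k _; congr (_ * _).
by apply: eq_bigr => h _; rewrite mulGA.
Qed.

(* n^-t times the sum, over the words j_1 ... j_t whose letters cover J, of the
   operator stepT j_1 o ... o stepT j_t. *)
Fixpoint coverC t (J : {set 'I_n}) f : G -> R :=
  if t is t'.+1 then fun g => n%:R^-1 * \sum_j stepT j (coverC t' (J :\ j) f) g
  else fun g => if J == finset.set0 then f g else 0.

Lemma coverC_avgE_comm t J r f :
  coverC t J (avgE (below r) f) = avgE (below r) (coverC t J f).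
Proof.
elim: t J => [|t IH] J /=; apply/funext => g.
  case: ifP => // _; rewrite /avgE big1 ?mulr0 //.
rewrite avgE_lin; congr (_ * _); apply: eq_bigr => j _.
by rewrite IH stepT_avgE_comm.
Qed.

(** Induction on the outermost letter [j]. If it is outside the interval, the remaining letters do
    everything. If it is inside, they enlarge [E_s] to [E_j], then [T_j] yields [E_{j+1}], which
    they enlarge to [E_r]; commutation lets the averages move through the word. *)
Lemma coverC_avgE t (J : {set 'I_n}) s r f : (s <= r <= n)%N ->
  (forall i : 'I_n, (s <= i < r)%N -> i \in J) ->
  coverC t J (avgE (below s) f) = coverC t J (avgE (below r) f).
Proof.
elim: t J s r => [|t IH] J s r /andP[sr rn] sJ /=; apply/funext => g.
  case: eqP => // J0.
  have [<-//|sr'] := eqVneq s r.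
  have {}sr' : (s < r)%N by rewrite ltn_neqAle sr' sr.
  have sn : (s < n)%N by apply: leq_trans rn.
  by have := sJ (Ordinal sn); rewrite /= leqnn sr' J0 inE => /(_ isT).
congr (_ * _); apply: eq_bigr => j _.
have [/andP[sj jr]|] := boolP (s <= j < r)%N; last first.
  move=> jsr; rewrite (IH _ s r) // ?sr //.
  move=> i isr; rewrite in_setD1 sJ // andbT.
  by apply: contraNneq jsr => <-.
rewrite (IH _ s j) ?sj 1?ltnW//; last first.
  move=> i /andP[si ij]; rewrite in_setD1 sJ ?si ?(ltn_trans ij) // andbT.
  by rewrite -val_eqE ltn_eqF.
rewrite coverC_avgE_comm stepT_avgES -coverC_avgE_comm.
rewrite (IH _ j.+1 r) ?jr//.
  by rewrite [in RHS]coverC_avgE_comm stepT_avgE_id// coverC_avgE_comm.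
move=> i /andP[ji ir]; rewrite in_setD1 sJ ?ir ?(leq_trans sj) 1?ltnW// andbT.
by rewrite -val_eqE gtn_eqF.
Qed.

(** Union bound for the coupon collector: each letter of [J] is absent from a random word of length
    [t] with probability [(1 - 1/n)^t]. *)
Lemma coverC_cst t (J : {set 'I_n}) (c : R) g : (0 < n)%N -> 0 <= c ->
  c * (1 - #|J|%:R * (1 - n%:R^-1) ^+ t) <= coverC t J (fun=> c) g.
Proof.
move=> n0 c0; elim: t J g => [|t IH] J g /=.
  rewrite expr0 mulr1; case: eqP => [->|/eqP J0]; first by rewrite cards0 subr0 mulr1.
  by rewrite mulr_ge0_le0 // subr_le0 ler1n card_gt0.
apply: (@le_trans _ _ (n%:R^-1 * \sum_(j : 'I_n)
    c * (1 - #|J :\ j|%:R * (1 - n%:R^-1) ^+ t))); last first.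
  apply: ler_wpM2l; first by rewrite invr_ge0.
  apply: ler_sum => j _.
  rewrite -[X in X <= _](@stepT_cst j (fun=> c * (1 - #|J :\ j|%:R * (1 - n%:R^-1) ^+ t)) g)//.
  exact: ler_stepT.
have nn : n%:R != 0 :> R by rewrite pnatr_eq0 -lt0n.
rewrite -mulr_sumr sumrB sumr_const card_ord -mulr_suml.
(* A random letter lies in [J] with probability [#|J| / n], so the mean of [#|J :\ j|] is [#|J|]
   times [1 - 1/n]. *)
have -> : \sum_(j : 'I_n) #|J :\ j|%:R = n%:R * #|J|%:R - #|J|%:R :> R.
  transitivity (\sum_(j : 'I_n) (#|J|%:R - (j \in J)%:R : R)).
    by apply: eq_bigr => j _; rewrite [in RHS](cardsD1 j) natrD addrAC subrr add0r.
  rewrite sumrB sumr_const card_ord mulr_natl -natr_sum.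
  by rewrite -big_mkcond sum1_card.
by rewrite exprS le_eqVlt; apply/orP; left; apply/eqP; field.
Qed.

Lemma coverC_le t J f : (forall g, 0 <= f g) ->
  forall g, coverC t J f g <= iter t stepK f g.
Proof.
move=> f0; elim: t J => [|t IH] J g /=; first by case: ifP.
apply: ler_wpM2l; first by rewrite invr_ge0.
by apply: ler_sum => j _; apply: ler_stepT.
Qed.

(** [E_0] is the identity and [E_n] the uniform mean: inserting the first and enlarging it along
    covering words leaves a constant, to which the union bound applies. *)
Lemma ost_t_expect_ge t f : (0 < n)%N -> (forall g, 0 <= f g) ->
  (\sum_g f g) / #|G|%:R * (1 - n%:R * (1 - n%:R^-1) ^+ t) <=
  \sum_g @ost_t R m.+1 n t g * f g.
Proof.
move=> n0 f0; rewrite sum_ost_t.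
apply: le_trans (coverC_le t finset.setT f0 _).
have e0 : avgE (below 0) f = f.
  apply/funext => g; rewrite /avgE (_ : below 0 = finset.set0) ?suppG0.
    by rewrite big_set1 cards1 invr1 mul1r mulG1.
  by apply/setP => i; rewrite !inE.
have en : avgE (below n) f = fun=> (\sum_g f g) / #|G|%:R.
  apply/funext => g; rewrite /avgE (_ : below n = finset.setT).
    rewrite suppGT cardsT mulrC; congr (_ / _).
    rewrite [RHS](reindex_inj (@mulGI m n g)).
    by apply: eq_bigl => h; rewrite inE.
  by apply/setP => i; rewrite !inE ltn_ord.
rewrite -[in X in _ <= X]e0 (@coverC_avgE _ _ 0 n) ?leqnn ?leq0n//; last first.
  by move=> i _; rewrite inE.
rewrite en; apply: le_trans (coverC_cst t finset.setT _ n0 _).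
  by rewrite cardsT card_ord.
by rewrite divr_ge0 // sumr_ge0.
Qed.

End Operators.

(** * Distances to uniformity *)

Section Distances.
Variables (R : realType) (m n : nat).
Notation G := (Gmn m n).
Variables P Q : G -> R.
Hypotheses (P1 : \sum_g P g = 1) (Q1 : \sum_g Q g = 1) (Q0 : forall g, 0 < Q g).

Lemma tv_dist_le c : (forall g, (1 - c) * Q g <= P g) -> tv_dist P Q <= c.
Proof.
move=> PQ; have c0 : 0 <= c.
  have : \sum_g (1 - c) * Q g <= \sum_g P g by apply: ler_sum => g _.
  by rewrite -mulr_sumr P1 Q1; lra.
rewrite /tv_dist -ler_pdivlMl ?invr_gt0// invrK.
(* Pointwise [P - Q >= - c Q] gives [|P - Q| <= (P - Q) + 2 c Q], and [P - Q] has total 0. *)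
apply: (@le_trans _ _ (\sum_g ((P g - Q g) + 2 * c * Q g))).
  apply: ler_sum => g _; have PQg := PQ g.
  have cQ0 : 0 <= c * Q g by rewrite mulr_ge0// ltW.
  by case: (ger0P (P g - Q g)) => ?; nra.
by rewrite big_split /= sumrB P1 Q1 -mulr_sumr Q1; lra.
Qed.

Lemma tv_dist_ge (A : {set G}) :
  \sum_(g in A) P g - \sum_(g in A) Q g <= tv_dist P Q.
Proof.
have PQ0 : \sum_g (P g - Q g) = 0 by rewrite sumrB P1 Q1 subrr.
rewrite /tv_dist -sumrB.
suff : 2 * \sum_(g in A) (P g - Q g) <= \sum_g `|P g - Q g| by lra.
move: PQ0; rewrite (bigID (mem A)) [X in _ <= X](bigID (mem A)) /=.
set a := \sum_(g in A) _; set b := \sum_(g | g \notin A) (_ - _) => ab.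
have : a <= \sum_(g in A) `|P g - Q g| by apply: ler_sum => g _; exact: ler_norm.
have : - b <= \sum_(g | g \notin A) `|P g - Q g|.
  by rewrite -sumrN; apply: ler_sum => g _; rewrite -normrN ler_norm.
lra.
Qed.

Variable hm : (0 < m)%N.

Lemma sep_dist_le c : (forall g, (1 - c) * Q g <= P g) -> sep_dist hm P Q <= c.
Proof.
move=> PQ; rewrite /sep_dist lerBlDr addrC -lerBlDr.
apply: (big_ind (fun x => 1 - c <= x)) => [|x y|g _].
- by rewrite ler_pdivlMr.
- by rewrite le_min => -> ->.
- by rewrite ler_pdivlMr.
Qed.

Lemma tv_le_sep_dist : tv_dist P Q <= sep_dist hm P Q.
Proof.
apply: tv_dist_le => g; rewrite /sep_dist subKr -ler_pdivlMr//.
exact: bigmin_le.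
Qed.

End Distances.

(** * Upper bound on the separation distance *)

Section UpperBound.
Variables (R : realType) (m n : nat).
Hypothesis n0 : (0 < n)%N.
Notation G := (Gmn m.+1 n).

Lemma unif_gt0 (g : G) : 0 < unif R g.
Proof. by rewrite /unif invr_gt0 ltr0n; apply/card_gt0P; exists g. Qed.

Lemma sum_unif : \sum_(g : G) unif R g = 1.
Proof.
rewrite /unif sumr_const -[X in X *+ _]mul1r -mulrnAr -mulr_natr mul1r mulVf//.
by rewrite pnatr_eq0 -lt0n; apply/card_gt0P; exists (oneG m n).
Qed.

Lemma stepK_cst (c : R) : stepK (fun=> c) = (fun=> c) :> (G -> R).
Proof.
apply/funext => g; rewrite /stepK (eq_bigr (fun=> c)).
  rewrite sumr_const card_ord -[c *+ _]mulr_natl mulrA mulVf ?mul1r//.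
  by rewrite pnatr_eq0 -lt0n.
by move=> j _; apply: stepT_cst.
Qed.

Lemma sum_ost_t1 t : \sum_(g : G) ost_t R t g = 1.
Proof.
under eq_bigr => g _ do rewrite -[ost_t _ _ _]mulr1.
by rewrite (sum_ost_t t (fun=> 1)) iter_fix // stepK_cst.
Qed.

Lemma sum_pred1_mul (F : G -> R) g : \sum_h F h * (h == g)%:R = F g.
Proof.
rewrite (bigD1 g) //= eqxx mulr1 big1 ?addr0// => h /negPf->.
by rewrite mulr0.
Qed.

Lemma ost_t_ge t (g : G) :
  (1 - n%:R * (1 - n%:R^-1) ^+ t) * unif R g <= ost_t R t g.
Proof.
rewrite -(sum_pred1_mul (ost_t R t) g).
apply: le_trans (ost_t_expect_ge _ n0 _); last by move=> h; rewrite ler0n.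
rewrite (_ : \sum_h (h == g)%:R = 1); first by rewrite mulrC /unif mul1r.
rewrite -[RHS](sum_pred1_mul (fun=> 1) g).
by apply: eq_bigr => h _; rewrite mul1r.
Qed.

Lemma stepK_ge0 (f : G -> R) : (forall g, 0 <= f g) -> forall g, 0 <= stepK f g.
Proof.
move=> f0 g; rewrite -[X in X <= _](mulr0 n%:R^-1).
apply: ler_wpM2l; first by rewrite invr_ge0.
apply: sumr_ge0 => j _; rewrite /stepT.
rewrite mulr_ge0 ?invr_ge0 ?mulr_ge0//.
by do 2 (apply: sumr_ge0 => ? _).
Qed.

Lemma ost_t_ge0 t (g : G) : 0 <= ost_t R t g.
Proof.
rewrite -(sum_pred1_mul (ost_t R t) g) sum_ost_t.
have : forall h : G, 0 <= (h == g)%:R :> R by move=> h; rewrite ler0n.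
move: (oneG m n); elim: t => [|t IH] x h0 /=; first exact: h0.
by apply: stepK_ge0 => y; apply: IH.
Qed.

Lemma sep_ost_le1 (hm : (0 < m.+1)%N) t :
  sep_dist hm (ost_t R t : G -> R) (@unif R m.+1 n) <= 1.
Proof.
apply: sep_dist_le => [|g]; first exact: unif_gt0.
by rewrite subrr mul0r ost_t_ge0.
Qed.

Lemma tv_ost_ge0 t : 0 <= tv_dist (ost_t R t : G -> R) (@unif R m.+1 n).
Proof. by rewrite /tv_dist mulr_ge0 ?invr_ge0// sumr_ge0. Qed.

Lemma tv_le_sep_ost (hm : (0 < m.+1)%N) t :
  tv_dist (ost_t R t : G -> R) (@unif R m.+1 n) <=
  sep_dist hm (ost_t R t : G -> R) (@unif R m.+1 n).
Proof. by apply: tv_le_sep_dist; [exact: sum_ost_t1|exact: sum_unif|exact: unif_gt0]. Qed.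

Lemma sep_ost_le (hm : (0 < m.+1)%N) t :
  sep_dist hm (ost_t R t : G -> R) (@unif R m.+1 n) <=
  n%:R * expR (- (t%:R / n%:R)).
Proof.
apply: (@le_trans _ _ (n%:R * (1 - n%:R^-1) ^+ t)).
  by apply: sep_dist_le => g; [exact: unif_gt0|exact: ost_t_ge].
apply: ler_wpM2l => //.
rewrite -mulrN -mulrC expRM_natr.
apply: lerXn2r; rewrite ?nnegrE ?expR_ge0 //.
  by rewrite subr_ge0 invf_le1 ?ltr0n// ler1n.
exact: expR_ge1Dx.
Qed.

End UpperBound.

(** * Untouched positions *)

Section Untouched.
Variables (R : realType) (m n : nat).
Hypothesis n0 : (0 < n)%N.
Notation G := (Gmn m.+1 n).
Implicit Types (F : 'I_n -> 'I_n -> R) (V J : {set 'I_n}) (i j a b : 'I_n).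

Let nn0 : n%:R != 0 :> R. Proof. by rewrite pnatr_eq0 -lt0n. Qed.

(** Expectation over the random pair of positions touched by one step. *)
Definition posE F : R :=
  n%:R^-1 * \sum_(j : 'I_n) j.+1%:R^-1 * \sum_(i : 'I_n | (i <= j)%N) F i j.

Lemma posE_sum (I : Type) (r : seq I) (c : I -> R) (F : I -> 'I_n -> 'I_n -> R) :
  posE (fun i j => \sum_(x <- r) c x * F x i j) = \sum_(x <- r) c x * posE (F x).
Proof.
transitivity (n%:R^-1 * \sum_(j : 'I_n) \sum_(x <- r)
    c x * (j.+1%:R^-1 * \sum_(i : 'I_n | (i <= j)%N) F x i j)).
  rewrite /posE; congr (_ * _); apply: eq_bigr => j _.
  rewrite exchange_big mulr_sumr; apply: eq_bigr => x _ /=.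
  by rewrite -mulr_sumr mulrCA.
rewrite exchange_big mulr_sumr; apply: eq_bigr => x _ /=.
by rewrite -mulr_sumr mulrCA.
Qed.

Lemma eq_posE F1 F2 : (forall i j, F1 i j = F2 i j) -> posE F1 = posE F2.
Proof.
move=> e; congr (_ * _); apply: eq_bigr => j _; congr (_ * _).
by apply: eq_bigr => i _.
Qed.

Lemma posED F1 F2 : posE (fun i j => F1 i j + F2 i j) = posE F1 + posE F2.
Proof.
rewrite /posE -mulrDr -big_split; congr (_ * _); apply: eq_bigr => j _ /=.
by rewrite big_split mulrDr.
Qed.

Lemma posE_cst (c : R) : posE (fun _ _ => c) = c.
Proof.
rewrite /posE (eq_bigr (fun=> c)) => [|j _].
  by rewrite sumr_const card_ord -[c *+ _]mulr_natl mulrA mulVf ?mul1r.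
by rewrite sumr_const card_ord_le -[c *+ _]mulr_natl mulrA mulVf ?mul1r ?pnatr_eq0.
Qed.

Lemma ler_posE F1 F2 : (forall i j, (i <= j)%N -> F1 i j <= F2 i j) ->
  posE F1 <= posE F2.
Proof.
move=> F12; apply: ler_wpM2l; first by rewrite invr_ge0.
apply: ler_sum => j _; apply: ler_wpM2l; first by rewrite invr_ge0.
by apply: ler_sum => i ij; apply: F12.
Qed.

Definition missE J : R := posE (fun i j => ((i \notin J) && (j \notin J))%:R).

(* Markov operator of the set V of positions not touched so far; the indicators of
   [J \subset V] are eigenfunctions. *)
Definition stepV (Psi : {set 'I_n} -> R) V : R :=
  posE (fun i j => Psi (V :\: [set i; j])).

(** [J] lies in [V :\: [set i; j]] exactly when it lies in [V] and avoids both indices, so its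
    indicator is scaled by [missE J]. The list encodes a linear combination of indicators. *)
Lemma iter_stepV t (r : seq (R * {set 'I_n})) V :
  iter t stepV (fun V => \sum_(p <- r) p.1 * (p.2 \subset V)%:R) V =
  \sum_(p <- r) p.1 * missE p.2 ^+ t * (p.2 \subset V)%:R.
Proof.
elim: t V => [|t IH] V /=; first by apply: eq_bigr => p _; rewrite expr0 mulr1.
rewrite /stepV (eq_posE (F2 := fun i j => \sum_(p <- r)
    (p.1 * missE p.2 ^+ t * (p.2 \subset V)%:R) *
    ((i \notin p.2) && (j \notin p.2))%:R)) => [|i j].
  by rewrite posE_sum; apply: eq_bigr => p _; rewrite -/(missE _) exprSr; ring.
rewrite IH; apply: eq_bigr => p _; rewrite -[RHS]mulrA -natrM mulnb.
congr (_ * (nat_of_bool _)%:R).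
by rewrite finset.subsetD disjoint_sym finset.disjoints_subset finset.subUset !finset.sub1set !inE.
Qed.

(** Coupling: a position fixed so far and avoided by the next generator stays fixed, so [V] remains
    inside the set of fixed positions. *)
Lemma stepK_ge_stepV (phi : G -> R) (Psi : {set 'I_n} -> R) :
  (forall g V, (forall l, l \in V -> fixes g l) -> Psi V <= phi g) ->
  forall t g V, (forall l, l \in V -> fixes g l) ->
  iter t stepV Psi V <= iter t (@stepK R m n) phi g.
Proof.
move=> PsiP; elim=> [|t IH] g V gV /=; first exact: PsiP.
rewrite /stepV /posE /stepK; apply: ler_wpM2l; first by rewrite invr_ge0.
apply: ler_sum => j _; rewrite /stepT invfM -mulrA.
apply: ler_wpM2l; first by rewrite invr_ge0.
rewrite mulr_sumr; apply: ler_sum => i ij.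
rewrite ler_pdivlMl ?ltr0n// mulr_natl -[X in _ *+ X]card_ord -sumr_const.
apply: ler_sum => k _; apply: IH => l.
rewrite finset.in_setD finset.in_set2 negb_or => /andP[/andP[li lj] lV].
by apply: fixesM; [exact: gV|exact: fixes_gen].
Qed.

(** Testing the permutation part alone keeps every element with an untouched position in [B], and
    reduces the uniform probability to counting permutations. *)
Definition fixG (B : {set 'I_n}) : {set G} := [set g : G | [exists a in B, g.2 a == a]].

Lemma sum_subset1 (B V : {set 'I_n}) :
  \sum_(a in B) ([set a] \subset V)%:R = #|B :&: V|%:R :> R.
Proof.
rewrite -natr_sum -big_mkcondr sum1_card; congr (_%:R).
by apply: eq_card => a; rewrite unfold_in finset.sub1set inE.
Qed.

(* Second moment method: the number N of untouched positions in B satisfies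
   1_{N > 0} >= 2 lam N - (lam N)^2, and untouched positions are fixed points. *)
Lemma ost_t_fixG_ge t (B : {set 'I_n}) (lam : R) :
  2 * lam * \sum_(a in B) missE [set a] ^+ t
  - lam ^+ 2 * \sum_(a in B) \sum_(b in B) missE [set a; b] ^+ t
  <= \sum_(g in fixG B) @ost_t R m.+1 n t g.
Proof.
(* The polynomial [2 lam N - lam^2 N^2] expanded over points and ordered pairs, diagonal
   included. *)
pose r := [seq (2 * lam, [set a]) | a <- enum B] ++
          [seq (- lam ^+ 2, [set a; b]) | a <- enum B, b <- enum B].
have sum_r (F : {set 'I_n} -> R) : \sum_(p <- r) p.1 * F p.2 =
    2 * lam * \sum_(a in B) F [set a]
    - lam ^+ 2 * \sum_(a in B) \sum_(b in B) F [set a; b].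
  rewrite big_cat big_map big_allpairs_dep /=; congr (_ + _).
    by rewrite big_enum mulr_sumr.
  rewrite big_enum [in RHS]mulr_sumr -[in RHS]sumrN; apply: eq_bigr => a _.
  rewrite big_enum [in RHS]mulr_sumr -[in RHS]sumrN; apply: eq_bigr => b _.
  by rewrite mulNr.
have -> : \sum_(g in fixG B) @ost_t R m.+1 n t g =
    \sum_g @ost_t R m.+1 n t g * (g \in fixG B)%:R.
  rewrite big_mkcond; apply: eq_bigr => g _.
  by case: ifP => _; rewrite ?mulr1 ?mulr0.
rewrite sum_ost_t -(sum_r (fun J => missE J ^+ t)).
apply: le_trans (@stepK_ge_stepV _
    (fun V => \sum_(p <- r) p.1 * (p.2 \subset V)%:R) _ t _ finset.setT _).
- rewrite iter_stepV le_eqVlt; apply/orP; left; apply/eqP.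
  by apply: eq_bigr => p _; rewrite finset.subsetT mulr1.
- move=> g V gV; rewrite (sum_r (fun J => (J \subset V)%:R)) sum_subset1.
  have -> : \sum_(a in B) \sum_(b in B) ([set a; b] \subset V)%:R =
            #|B :&: V|%:R ^+ 2 :> R.
    rewrite expr2 -sum_subset1 mulr_suml; apply: eq_bigr => a _.
    rewrite mulr_sumr; apply: eq_bigr => b _.
    by rewrite -natrM mulnb finset.subUset.
  have [/eqP|BV0] := posnP #|B :&: V|.
    by rewrite cards_eq0 => /eqP->; rewrite cards0 expr0n /= !mulr0 subr0 ler0n.
  have /card_gt0P[a] := BV0; rewrite inE => /andP[aB aV].
  have -> : (g \in fixG B)%:R = 1 :> R.
    rewrite (_ : g \in fixG B) // inE; apply/existsP; exists a; rewrite aB /=.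
    by have /andP[] := gV _ aV.
  (* This is [1 - (1 - lam N)^2 <= 1]. *)
  by rewrite -subr_ge0; set N := #|_|%:R; apply: le_trans (sqr_ge0 (1 - lam * N)) _; lra.
- by move=> l _; rewrite /fixes ffunE perm1 !eqxx.
Qed.

(** * Estimates for the positions from [d] on *)

Section TopBlock.
Variable d : nat.
Hypotheses (d1 : (1 < d)%N) (dn : (d <= n)%N).
Definition topB : {set 'I_n} := [set l : 'I_n | (d <= l)%N].

Lemma card_topB : #|topB| = (n - d)%N.
Proof.
have e : #|~: topB| = d.
  rewrite -sum1_card -[RHS]card_ord -sum1_card (big_ord_widen n (fun=> 1%N) dn).
  by apply: eq_bigl => l; rewrite !inE -ltnNge.
have := cardsC topB; rewrite e card_ord => h.
by rewrite -[LHS](addnK d) h.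
Qed.

Let dR : 2 <= d%:R :> R. Proof. by rewrite ler_nat. Qed.
Let d0 : 0 < d%:R :> R. Proof. by rewrite ltr0n ltnW. Qed.
Let dnR : d%:R <= n%:R :> R. Proof. by rewrite ler_nat. Qed.
Let nR : 0 < n%:R :> R. Proof. by rewrite ltr0n. Qed.

Lemma invS_le j : j \in topB -> j.+1%:R^-1 <= d%:R^-1 :> R.
Proof.
by rewrite inE => dj; rewrite lef_pV2 ?posrE ?ltr0n ?ler_nat ?(ltnW d1)// leqW.
Qed.

Lemma missE_le1 J : missE J <= 1.
Proof.
rewrite -[X in _ <= X](posE_cst 1); apply: ler_posE => i j _.
by rewrite lern1 leq_b1.
Qed.

Lemma missE_ge0 J : 0 <= missE J.
Proof.
by rewrite -[X in X <= _](posE_cst 0); apply: ler_posE => i j _; rewrite ler0n.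
Qed.

Lemma posE_right (c : 'I_n -> R) :
  posE (fun _ j => c j) = n%:R^-1 * \sum_j c j.
Proof.
congr (_ * _); apply: eq_bigr => j _.
by rewrite sumr_const card_ord_le -[c j *+ _]mulr_natl mulrA mulVf ?mul1r ?pnatr_eq0.
Qed.

Lemma posE_left a (c : 'I_n -> R) :
  posE (fun i j => (i == a)%:R * c j) =
  n%:R^-1 * \sum_(j : 'I_n | (a <= j)%N) j.+1%:R^-1 * c j.
Proof.
rewrite /posE [in RHS]big_mkcond; congr (_ * _); apply: eq_bigr => j _.
rewrite -mulr_suml; case: ifPn => aj.
  rewrite (bigD1 a) //= eqxx big1 ?addr0 ?mul1r// => i /andP[_ /negPf->].
  by [].
rewrite big1 ?mul0r ?mulr0// => i ij; case: eqVneq => // ia.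
by rewrite -ia ij in aj.
Qed.

(* A position a >= d is hit with probability at most 1/n + (n - d)/(n d) = 1/d. *)
Lemma missE1_ge a : a \in topB -> 1 - d%:R^-1 <= missE [set a].
Proof.
move=> aB; pose e i j : R := (i == a)%:R * (j != a)%:R.
(* Either [a] is missed, or it is the right-hand position, or it is the left-hand one for another
   [j]. *)
have h : posE (fun _ _ => 1) <=
    posE (fun i j => ((i \notin [set a]) && (j \notin [set a]))%:R
                     + ((j == a)%:R + e i j)).
  apply: ler_posE => i j _; rewrite /e !inE.
  by case: (i == a); case: (j == a) => /=; lra.
rewrite posE_cst posED -/(missE _) posED posE_right posE_left in h.
have s1 : \sum_j (j == a)%:R = 1 :> R.
  by rewrite (bigD1 a) //= eqxx big1 ?addr0// => j /negPf->.
(* A left-hand hit requires [j >= a]; at most [n - d] values of [j] qualify, each hitting with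
   conditional probability at most [1/d]. *)
have s2 : \sum_(j : 'I_n | (a <= j)%N) j.+1%:R^-1 * (j != a)%:R <= (n%:R - d%:R) / d%:R :> R.
  rewrite -natrB// -card_topB mulr_natl -sumr_const big_mkcond [leRHS]big_mkcond.
  apply: ler_sum => j _; have [aj|_] := leqP a j; last first.
    by case: ifP => // _; rewrite invr_ge0 ler0n.
  have jB : j \in topB by move: aB; rewrite !inE => /leq_trans; apply.
  rewrite jB; apply: le_trans (invS_le jB).
  by rewrite ler_piMr ?invr_ge0// lern1 leq_b1.
have n1 : 0 < n%:R^-1 :> R by rewrite invr_gt0 ltr0n.
have {s2} := ler_wpM2l (ltW n1) s2.
have -> : n%:R^-1 * ((n%:R - d%:R) / d%:R) = d%:R^-1 - n%:R^-1 :> R.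
  by field; rewrite nn0 gt_eqF.
move=> s2; rewrite s1 mulr1 in h; move: h s2; set x := _ * \sum_(_ | _) _.
lra.
Qed.

(** Let [x], [y] be the single probabilities. Inclusion-exclusion gives [x + y - 1], which is at
    most [x y], plus the chance of touching both positions in one step, at most [2 / d^2]. Since
    [x y >= 1/4], the latter is at most [x y] times [8 / d^2]. *)
Lemma missE2_le a b : a \in topB -> b \in topB -> a != b ->
  missE [set a; b] <=
  missE [set a] * missE [set b] * (1 + 8 / d%:R ^+ 2).
Proof.
move=> aB bB ab.
have eb x y : x \in topB -> y \in topB ->
    posE (fun i j => (i == x)%:R * (j == y)%:R) <= (d%:R ^+ 2)^-1.
  move=> xB yB; rewrite posE_left expr2 invfM ler_pM ?invr_ge0//.
  - by rewrite sumr_ge0// => j _; rewrite mulr_ge0 ?invr_ge0.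
  - by rewrite lef_pV2 ?posrE ?nR.
  rewrite -(mulr1 d%:R^-1) big_mkcond (bigD1 y) //= eqxx big1 ?addr0 => [|j /negPf->].
    by case: ifP => _; rewrite !mulr1 ?invS_le// invr_ge0.
  by rewrite mulr0 if_same.
have : missE [set a; b] <= posE (fun i j => 
   ((i \notin [set a]) && (j \notin [set a]))%:R +
   (((i \notin [set b]) && (j \notin [set b]))%:R +
    (-1 + ((i == a)%:R * (j == b)%:R + (i == b)%:R * (j == a)%:R)))).
  apply: ler_posE => i j _; rewrite !inE !negb_or.
  have [->|ia] := eqVneq i a; have [->|ja] := eqVneq j a.
  - by rewrite (negPf ab) /=; lra.
  - by rewrite (negPf ab); case: (j == b) => /=; lra.
  - by rewrite (negPf ab); case: (i == b) => /=; lra.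
  - by case: (i == b); case: (j == b) => /=; lra.
rewrite !posED -!/(missE _) posE_cst.
have := eb a b aB bB; have := eb b a bB aB.
have := missE1_ge aB; have := missE1_ge bB.
have := missE_le1 [set a]; have := missE_le1 [set b].
have : d%:R^-1 <= 2^-1 :> R by rewrite lef_pV2 ?posrE ?ltr0Sn.
rewrite -exprVn; set D := d%:R^-1.
set x := missE [set a]; set y := missE [set b]; set z := missE _.
set u := posE _; set v := posE _ => D2 y1 x1 yD xD uD vD zuv.
have xy : 4^-1 <= x * y.
  apply: (@le_trans _ _ (2^-1 * 2^-1)); first lra.
  by apply: ler_pM; lra.
have : (1 - x) * (1 - y) >= 0 by rewrite mulr_ge0// subr_ge0.
have : (x * y - 4^-1) * D ^+ 2 >= 0 by rewrite mulr_ge0 ?sqr_ge0// subr_ge0.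
lra.
Qed.

Lemma card_perm_fix a : (#|[set s : {perm 'I_n} | s a == a]| * n = #|{perm 'I_n}|)%N.
Proof.
rewrite -[in RHS]sum1_card (partition_big (fun s : {perm 'I_n} => s a) predT) //=.
rewrite (eq_bigr (fun=> #|[set s : {perm 'I_n} | s a == a]|)).
  by rewrite sum_nat_const card_ord mulnC.
move=> b _; rewrite -sum1_card.
rewrite (reindex_inj (mulIg (tperm a b))) /=; apply: eq_bigl => s.
by rewrite inE permM -{2}(tpermL a b) (inj_eq perm_inj).
Qed.

Lemma sum_unif_fixG : \sum_(g in fixG topB) @unif R m.+1 n g <= (n - d)%:R / n%:R.
Proof.
apply: (@le_trans _ _ (\sum_(a in topB) \sum_(g : G | g.2 a == a) @unif R m.+1 n g)).
  rewrite big_mkcond (exchange_big_dep predT) //=; apply: ler_sum => g _.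
  have u0 : 0 <= @unif R m.+1 n g by exact/ltW/unif_gt0.
  case: ifP => [|_]; last exact: sumr_ge0.
  rewrite inE => /existsP[a /andP[aB ga]].
  by rewrite (bigD1 a) /= ?aB//= lerDl sumr_ge0.
rewrite -card_topB mulr_natl -sumr_const le_eqVlt; apply/orP; left; apply/eqP.
apply: eq_bigr => a _; rewrite /unif sumr_const.
rewrite (_ : #|_| =
  (#|{ffun 'I_n -> 'I_m.+1}| * #|[set s : {perm 'I_n} | s a == a]|)%N); last first.
  rewrite -cardsT -cardsX -[RHS]cardsE; apply: eq_card => -[f s].
  by rewrite !inE.
rewrite card_prod -(card_perm_fix a) mulnA; set c := (_ * #|_|)%N.
rewrite natrM invfM -[_ *+ c]mulr_natl mulrA mulfV ?mul1r//.
rewrite pnatr_eq0 -lt0n muln_gt0; apply/andP; split; apply/card_gt0P.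
  by exists [ffun=> 0].
by exists 1%g; rewrite inE perm1.
Qed.

(** Inverting [1 + x <= exp x] at [x = 1/(d-1)] gives [exp(- 1/(d-1)) <= 1 - 1/d]. *)
Lemma expR_le_missE1 t a : a \in topB ->
  expR (- (t%:R / (d%:R - 1))) <= missE [set a] ^+ t.
Proof.
move=> aB; rewrite mulrC -mulNr expRM_natr.
apply: lerXn2r; rewrite ?nnegrE ?expR_ge0//.
  by apply: le_trans (missE1_ge aB); rewrite subr_ge0 invf_le1// ler1n ltnW.
apply: le_trans (missE1_ge aB).
rewrite expRN -[X in _ <= X]invrK lef_pV2 ?posrE ?expR_gt0 ?invr_gt0 ?subr_gt0 ?invf_lt1 ?ltr1n//.
apply: le_trans (expR_ge1Dx _); rewrite le_eqVlt; apply/orP; left; apply/eqP.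
by field; rewrite !gt_eqF ?subr_gt0 ?ltr1n.
Qed.

(** The subtracted terms come from the mean number of untouched positions, the dependence within
    pairs, and the fixed points of a uniform element. *)
Lemma tv_ost_ge t : (d < n)%N ->
  2 - ((n - d)%:R * expR (- (t%:R / (d%:R - 1))))^-1
    - expR (8 * t%:R / d%:R ^+ 2) - (n - d)%:R / n%:R <=
  tv_dist (ost_t R t : G -> R) (@unif R m.+1 n).
Proof.
move=> dn'.
apply: le_trans (tv_dist_ge _ _ (fixG topB)); [|exact: sum_ost_t1|exact: sum_unif].
apply: lerB; last exact: sum_unif_fixG.
pose mu := \sum_(a in topB) missE [set a] ^+ t.
have c0 : 0 < (n - d)%:R * expR (- (t%:R / (d%:R - 1))) :> R.
  by rewrite mulr_gt0 ?expR_gt0// ltr0n subn_gt0.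
have mu_ge : (n - d)%:R * expR (- (t%:R / (d%:R - 1))) <= mu.
  rewrite -card_topB mulr_natl -sumr_const; apply: ler_sum => a.
  exact: expR_le_missE1.
have mu0 : 0 < mu by apply: lt_le_trans mu_ge.
have e1 : (1 + 8 / d%:R ^+ 2) ^+ t <= expR (8 * t%:R / d%:R ^+ 2) :> R.
  by rewrite -mulrA [t%:R * _]mulrC mulrA expRM_natr lerXn2r ?nnegrE ?expR_ge0 ?expR_ge1Dx//.
have mu2 : \sum_(a in topB) \sum_(b in topB) missE [set a; b] ^+ t <=
    mu + mu ^+ 2 * expR (8 * t%:R / d%:R ^+ 2).
  rewrite expr2 {1 2}/mu mulr_suml mulr_suml -big_split /=; apply: ler_sum => a aB.
  rewrite (bigD1 a) //= finset.setUid lerD2l mulr_sumr mulr_suml.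
  rewrite [leRHS](bigD1 a) //= ler_wpDl//.
    by rewrite !mulr_ge0 ?exprn_ge0 ?expR_ge0 ?missE_ge0.
  apply: ler_sum => b /andP[bB ba].
  apply: (@le_trans _ _ ((missE [set a] * missE [set b] * (1 + 8 / d%:R ^+ 2)) ^+ t)).
    have [a0 b0] := (missE_ge0 [set a], missE_ge0 [set b]).
    have d8 : 0 <= 1 + 8 / d%:R ^+ 2 :> R by rewrite addr_ge0// divr_ge0// sqr_ge0.
    apply: lerXn2r; rewrite ?nnegrE ?missE_ge0//.
      exact: mulr_ge0 (mulr_ge0 a0 b0) d8.
    by apply: missE2_le => //; rewrite eq_sym.
  by rewrite 2!exprMn ler_wpM2l// mulr_ge0// exprn_ge0// missE_ge0.
(* With [lam = 1/mu] the first moment contributes 2, and the second at most [1/mu] plus the pair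
   factor. *)
apply: le_trans (ost_t_fixG_ge t topB mu^-1); rewrite -/mu.
have -> : 2 * mu^-1 * mu = 2 by field; rewrite gt_eqF.
have h : (mu^-1) ^+ 2 * \sum_(a in topB) \sum_(b in topB) missE [set a; b] ^+ t <=
   mu^-1 + expR (8 * t%:R / d%:R ^+ 2).
  have := ler_wpM2l (sqr_ge0 mu^-1) mu2; move/le_trans; apply.
  rewrite le_eqVlt; apply/orP; left; apply/eqP; field.
  by rewrite gt_eqF.
have : mu^-1 <= ((n - d)%:R * expR (- (t%:R / (d%:R - 1))))^-1 by rewrite lef_pV2.
lra.
Qed.

End TopBlock.
End Untouched.

(** * Asymptotics *)

Local Open Scope classical_set_scope.

Section Asymptotics.
Variable R : realType.

Let L n : R := ln n%:R.
Let s n : R := Num.sqrt (L n).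
(* The summand 1 only makes the window positive at n <= 1, where ln n = 0. *)
Let w n : R := n%:R * s n + 1.

Let s_cvg : s n @[n --> \oo] --> +oo.
Proof.
apply/cvgryPge => A; near=> n.
have nA : expR (A ^+ 2) <= n%:R :> R by near: n; exact: nbhs_infty_ger.
apply: (le_trans (ler_norm A)); rewrite -sqrtr_sqr ler_sqrt.
  by rewrite -ler_expR lnK// posrE (lt_le_trans (expR_gt0 _) nA).
rewrite -ler_expR expR0 lnK ?posrE ?(lt_le_trans (expR_gt0 _) nA)//.
by rewrite (le_trans _ nA)// -expR0 ler_expR sqr_ge0.
Unshelve. all: end_near. Qed.

Let near_s (A : R) : \forall n \near \oo, A <= s n.
Proof. exact: (cvgryPge _).1 s_cvg A. Qed.

Let s_sqr n : 0 < s n -> s n ^+ 2 = L n.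
Proof.
rewrite /s; have [L0 _|L0] := leP 0 (L n); first by rewrite sqr_sqrtr.
by rewrite ltr0_sqrtr// ltxx.
Qed.

Let n_gt0 n : 0 < s n -> (0 < n)%N.
Proof. by case: n => //; rewrite /s /L ln0// sqrtr0 ltxx. Qed.

Let n_expL n : 0 < s n -> n%:R = expR (L n) :> R.
Proof. by move=> /n_gt0 n0; rewrite lnK// posrE ltr0n. Qed.

Let sV_cvg : (s n)^-1 @[n --> \oo] --> 0.
Proof.
apply/gtr0_cvgV0; last exact: s_cvg.
by near=> n; apply: (@lt_le_trans _ _ 1) => //; near: n; exact: near_s.
Unshelve. all: end_near. Qed.

Let w_gt0 n : 0 < w n.
Proof. by rewrite ltr_wpDl// mulr_ge0// sqrtr_ge0. Qed.

Let w_cvg : w n / (n%:R * ln n%:R) @[n --> \oo] --> 0.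
Proof.
have : (s n)^-1 + (s n)^-1 * (s n)^-1 @[n --> \oo] --> (0 + 0 * 0 : R).
  by apply: cvgD => //; exact: cvgM.
rewrite mul0r addr0; apply: squeeze_cvgr; last exact: cvg_cst.
near=> n.
have s1 : 1 <= s n by near: n; exact: near_s.
have s0 : 0 < s n by apply: lt_le_trans s1.
have n1 : 1 <= n%:R :> R by rewrite ler1n n_gt0.
rewrite -/(L n) -s_sqr// (divr_ge0 (ltW (w_gt0 n)) (mulr_ge0 (ler0n _ _) (sqr_ge0 _)))/=.
have -> : w n / (n%:R * s n ^+ 2) = (s n)^-1 + n%:R^-1 * ((s n)^-1 * (s n)^-1).
  by rewrite /w; field; rewrite !gt_eqF// ltr0n n_gt0.
rewrite lerD2l ler_piMl ?mulr_ge0 ?invr_ge0 ?sqrtr_ge0// invf_le1//.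
by rewrite ltr0n n_gt0.
Unshelve. all: end_near. Qed.

(** Convergence for each fixed [a] makes the inner limits exactly 0 for [a > 0] and 1 for [a < -1],
    so the outer limits are those of eventually constant functions. *)
Let has_cutoff_of_limits (d : nat -> nat -> R) :
  (forall a, 0 < a -> at_real_time (d n) (n%:R * L n + a * w n) @[n --> \oo] --> (0 : R)) ->
  (forall a, 1 <= a -> at_real_time (d n) (n%:R * L n - a * w n) @[n --> \oo] --> (1 : R)) ->
  has_cutoff d (fun n => n%:R * ln n%:R).
Proof.
move=> up low; exists w; split=> //; split=> //; split.
- apply: cvg_near_cst; exists (-1); split; first by rewrite realE lerN10 orbT.
  move=> a a1 /=; apply: (cvg_limn_inf_sup _).1.
  rewrite -[a]opprK.
  under eq_fun do rewrite mulNr.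
  by apply: low; rewrite lerNr ltW.
- apply: cvg_near_cst; exists 0; split=> // a a0 /=.
  by apply: (cvg_limn_inf_sup _).2; exact: up.
Qed.

Variables (m : nat) (hm : (0 < m.+1)%N).
Let tv n t := tv_dist (@ost_t R m.+1 n t) (@unif R m.+1 n).
Let sep n t := sep_dist hm (@ost_t R m.+1 n t) (@unif R m.+1 n).

Let sep_up a : 0 < a ->
  \forall n \near \oo,
    at_real_time (sep n) (n%:R * L n + a * w n) <= expR 1 / a * (s n)^-1.
Proof.
move=> a0; near=> n.
have s0 : 0 < s n by apply: (@lt_le_trans _ _ 1) => //; near: n; exact: near_s.
have n0 := n_gt0 s0.
have nR : 0 < n%:R :> R by rewrite ltr0n.
rewrite /at_real_time; set x := _ + _.
apply: le_trans (sep_ost_le R n0 hm _) _.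
have tx : x - 1 <= (Num.truncn x)%:R.
  by rewrite lerBlDr natr1 ltW// truncnS_gt.
rewrite [X in X * _]n_expL// -expRD.
(* Rounding the time down loses at most one step, hence at most 1 in the exponent. *)
apply: (@le_trans _ _ (expR (1 - a * s n))).
  rewrite ler_expR.
  suff : L n + a * s n - 1 <= (Num.truncn x)%:R / n%:R by lra.
  rewrite ler_pdivlMr//; apply: le_trans tx; rewrite /x /w.
  have : 1 <= n%:R :> R by rewrite ler1n.
  lra.
rewrite expRD expRN -mulrA ler_wpM2l ?expR_ge0// -invfM.
rewrite lef_pV2 ?posrE ?expR_gt0 ?mulr_gt0//.
by apply: le_trans (expR_ge1Dx _); rewrite lerDr.
Unshelve. all: end_near. Qed.

(** Here [d = n - b] with [b] the integer part of [n / ln n]: few enough positions for a uniform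
    fixed point among them to be rare, enough for the mean number of untouched ones to diverge. *)
Let tv_low a : 1 <= a ->
  \forall n \near \oo,
    2 - 12 * expR 4 * (s n)^-1 - expR (64 * (s n)^-1 ^+ 2) - (s n)^-1 ^+ 2 <=
    at_real_time (tv n) (n%:R * L n - a * w n).
Proof.
move=> a1; near=> n.
have s3 : 3 <= s n by near: n; exact: near_s.
have s0 : 0 < s n by lra.
have n0 := n_gt0 s0.
have nR : 0 < n%:R :> R by rewrite ltr0n.
have Ls := s_sqr s0.
have L8 : 8 <= L n by rewrite -Ls; nra.
have nL : 1 + L n ^+ 2 / 2 <= n%:R.
  by rewrite (n_expL s0); apply: le_trans (expR_ge1Dxn 1 _); rewrite ?lexx//; lra.
have n4L : 4 * L n <= n%:R by nra.
rewrite /at_real_time; set t := Num.truncn _.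
have tn : t%:R <= n%:R * (L n - s n).
  have Lsn : 0 <= L n - s n by rewrite -Ls; nra.
  have y0 : 0 <= n%:R * (L n - s n) by rewrite mulr_ge0// ltW.
  apply: (@le_trans _ _ (Num.truncn (n%:R * (L n - s n)))%:R); last by rewrite truncn_le.
  rewrite ler_nat le_truncn// mulrBr lerB// /w.
  have : n%:R * s n <= a * (n%:R * s n) by rewrite ler_peMl// (mulr_ge0 (ler0n _ _) (ltW s0)).
  lra.
pose b := Num.truncn (n%:R / L n).
have L0 : 0 < L n by lra.
have bn : b%:R <= n%:R / L n by rewrite truncn_le divr_ge0 ?ltW.
have nb : n%:R / L n - 1 <= b%:R.
  by rewrite lerBlDr natr1 ltW// truncnS_gt.
have nL4 : 4 <= n%:R / L n by rewrite ler_pdivlMr.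
have nLn : n%:R / L n <= n%:R / 8 by rewrite ler_pM2l// lef_pV2 ?posrE.
have bn' : (b <= n)%N by rewrite -(@ler_nat R); lra.
have dE : (n - b)%:R = n%:R - b%:R :> R by rewrite natrB.
have d1 : (1 < n - b)%N by rewrite -(@ltr_nat R) dE; lra.
have dn : (n - b < n)%N by rewrite -(@ltr_nat R) dE; lra.
apply: le_trans (tv_ost_ge R m n0 d1 (ltnW dn) t dn).
rewrite subKn// dE.
have v2 : (s n)^-1 ^+ 2 = (L n)^-1 by rewrite exprVn Ls.
have L10 : 0 < (L n)^-1 by rewrite invr_gt0.
have h3 : b%:R / n%:R <= (s n)^-1 ^+ 2 by rewrite v2 ler_pdivrMr// mulrC.
(* The exponent has order [L n / n]; the bound [n >= (L n)^2 / 2] turns this into a multiple of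
   [1 / L n]. *)
have h2 : expR (8 * t%:R / (n%:R - b%:R) ^+ 2) <= expR (64 * (s n)^-1 ^+ 2).
  rewrite ler_expR v2 ler_pdivrMr; last by rewrite exprn_gt0//; lra.
  have nd : n%:R ^+ 2 / 2 <= (n%:R - b%:R) ^+ 2 :> R.
    have : 7/8 * n%:R <= n%:R - b%:R :> R by lra.
    by nra.
  have h : 64 * (L n)^-1 * (n%:R ^+ 2 / 2) <= 64 * (L n)^-1 * (n%:R - b%:R) ^+ 2.
    by rewrite ler_wpM2l// mulr_ge0// ltW.
  apply: le_trans h.
  have h : 64 * (L n)^-1 * (n%:R * (L n ^+ 2 / 2) / 2) <= 64 * (L n)^-1 * (n%:R ^+ 2 / 2).
    by rewrite ler_wpM2l ?mulr_ge0 ?ltW//; nra.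
  apply: le_trans h.
  have -> : 64 * (L n)^-1 * (n%:R * (L n ^+ 2 / 2) / 2) = 16 * n%:R * L n.
    by field; rewrite gt_eqF.
  have : 0 <= n%:R * s n by rewrite mulr_ge0 ?ltW.
  have : 0 <= n%:R * L n by rewrite mulr_ge0 ?ltW.
  lra.
have h1 : (b%:R * expR (- (t%:R / (n%:R - b%:R - 1))))^-1 <= 12 * expR 4 * (s n)^-1.
  (* Dividing by [d - 1] instead of [n] costs a bounded amount because [b <= n / L n]; 4
     suffices. *)
  have e1 : t%:R / (n%:R - b%:R - 1) <= L n - s n + 4.
    rewrite ler_pdivrMr; last lra.
    apply: le_trans tn _.
    have nLL : n%:R / L n * L n = n%:R by rewrite divfK// gt_eqF.
    nra.
  have e2 : s n ^+ 3 / 6 <= expR (s n).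
    by apply: le_trans (expR_ge1Dxn 2 (ltW s0)); rewrite lerDr.
  (* The mean is at least [n / (2 L n) * exp(s n - L n - 4)]; with [n = exp (L n)],
     [exp (s n) >= (s n)^3 / 6] and [L n = (s n)^2] this is at least [s n / (12 exp 4)]. *)
  have -> : 12 * expR 4 * (s n)^-1 =
      (n%:R / (2 * L n) * (expR (- L n) * (s n ^+ 3 / 6) * expR (- 4)))^-1.
    rewrite (n_expL s0) !expRN -Ls; field.
    by rewrite !gt_eqF// expR_gt0.
  rewrite lef_pV2 ?posrE.
  - apply: ler_pM.
    + by apply: ltW; rewrite divr_gt0// mulr_gt0.
    + by apply: ltW; rewrite !mulr_gt0 ?invr_gt0 ?expR_gt0 ?exprn_gt0.
    + apply: le_trans nb; rewrite invfM mulrCA; lra.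
    + apply: (@le_trans _ _ (expR (- (L n - s n + 4)))); last by rewrite ler_expR lerN2.
      rewrite !opprD opprK !expRD ler_wpM2r ?expR_ge0// ler_wpM2l ?expR_ge0//.
  - by rewrite mulr_gt0 ?expR_gt0//; lra.
  - apply: mulr_gt0; first by rewrite divr_gt0// mulr_gt0.
    have p6 : 0 < s n ^+ 3 / 6 by rewrite divr_gt0// exprn_gt0.
    exact: mulr_gt0 (mulr_gt0 (expR_gt0 _) p6) (expR_gt0 _).
lra.
Unshelve. all: end_near. Qed.

Let near_tv : \forall n \near \oo, forall t,
  [/\ 0 <= tv n t, tv n t <= sep n t & sep n t <= 1].
Proof.
near=> n; have n0 : (0 < n)%N by near: n; exact: nbhs_infty_gt.
by move=> t; split; [exact: tv_ost_ge0|exact: tv_le_sep_ost|exact: sep_ost_le1].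
Unshelve. all: end_near. Qed.

(** Serves both distances at once: [0 <= tv <= d <= sep <= 1] squeezes [d] between the two
    bounds. *)
Lemma ost_cutoff (d : nat -> nat -> R) :
  (\forall n \near \oo, forall t, tv n t <= d n t <= sep n t) ->
  has_cutoff d (fun n => n%:R * ln n%:R).
Proof.
move=> tvd; apply: has_cutoff_of_limits => a a0.
  have lim0 : expR 1 / a * (s n)^-1 @[n --> \oo] --> (expR 1 / a * 0 : R).
    by apply: cvgM => //; exact: cvg_cst.
  rewrite mulr0 in lim0; apply: squeeze_cvgr lim0; last exact: cvg_cst.
  near=> n.
  have h : forall t, tv n t <= d n t <= sep n t by near: n.
  have h' : forall t, [/\ 0 <= tv n t, tv n t <= sep n t & sep n t <= 1] by near: n.
  have u : at_real_time (sep n) (n%:R * L n + a * w n) <= expR 1 / a * (s n)^-1.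
    by near: n; exact: sep_up.
  move: u; rewrite /at_real_time; set t := Num.truncn _ => u.
  have /andP[td ds] := h t; have [t0 _ _] := h' t.
  by rewrite (le_trans t0 td) (le_trans ds u).
have lim1 : 2 - 12 * expR 4 * (s n)^-1 - expR (64 * (s n)^-1 ^+ 2) - (s n)^-1 ^+ 2
    @[n --> \oo] --> (2 - 12 * expR 4 * 0 - expR (64 * (0 * 0)) - 0 * 0 : R).
  have c2 : (s n)^-1 ^+ 2 @[n --> \oo] --> (0 * 0 : R) by exact: cvgM.
  apply: cvgB => //; apply: cvgB.
    by apply: cvgB; [exact: cvg_cst|apply: cvgM => //; exact: cvg_cst].
  have c3 : 64 * (s n)^-1 ^+ 2 @[n --> \oo] --> (64 * (0 * 0) : R).
    by apply: cvgM => //; exact: cvg_cst.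
  exact: cvg_comp c3 (@continuous_expR R _).
rewrite !(mulr0, mul0r, subr0) expR0 (_ : 2 - 1 = 1 :> R) in lim1; last lra.
apply: squeeze_cvgr lim1 _; last exact: cvg_cst.
near=> n.
have h : forall t, tv n t <= d n t <= sep n t by near: n.
have h' : forall t, [/\ 0 <= tv n t, tv n t <= sep n t & sep n t <= 1] by near: n.
have l : 2 - 12 * expR 4 * (s n)^-1 - expR (64 * (s n)^-1 ^+ 2) - (s n)^-1 ^+ 2 <=
    at_real_time (tv n) (n%:R * L n - a * w n).
  by near: n; exact: tv_low.
move: l; rewrite /at_real_time; set t := Num.truncn _ => l.
have /andP[td ds] := h t; have [_ _ s1] := h' t.
by rewrite (le_trans l td) (le_trans ds s1).
Unshelve. all: end_near. Qed.

Lemma tv_cutoff : has_cutoff tv (fun n => n%:R * ln n%:R).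
Proof.
by apply: ost_cutoff; apply: filterS near_tv => n h t; have [_ ->] := h t; rewrite lexx.
Qed.

Lemma sep_cutoff : has_cutoff sep (fun n => n%:R * ln n%:R).
Proof.
by apply: ost_cutoff; apply: filterS near_tv => n h t; have [_ ->] := h t; rewrite lexx.
Qed.

End Asymptotics.

Theorem theorem5p1 (R : realType) (m : nat) (hm : (0 < m)%N) :
  has_cutoff (fun n s => tv_dist (@ost_t R m n s) (@unif R m n))
             (fun n => n%:R * ln (n%:R : R)) /\
  has_cutoff (fun n s => sep_dist hm (@ost_t R m n s) (@unif R m n))
             (fun n => n%:R * ln (n%:R : R)).
Proof.
case: m hm => [//|m] hm.
by split; [exact: tv_cutoff|exact: sep_cutoff].
Qed.
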